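(* Let $G$ be a graph of order $n$. Suppose that $n=2^{p}(2k+1)$ for some natural numbers $p,k$, and that there is a constant integer $c$ such that $\deg(v)\equiv c \pmod{2^{p+2}}$ for every $v\in V(G)$. Then $G\times C_4$ is a group distance magic graph, i.e. for every Abelian group $\Gamma$ of order $4n$ there exists a $\Gamma$-distance magic labeling of $G\times C_4$.
   Context: All graphs are simple and finite; natural numbers include $0$. $C_m$ denotes the cycle on $m$ vertices. The direct product $G\times H$ has vertex set $V(G)\times V(H)$, and $(g,h)$ is adjacent to $(g',h')$ if and only if $g$ is adjacent to $g'$ in $G$ and $h$ is adjacent to $h'$ in $H$. For a graph $X$ with $N$ vertices and an (additively written) Abelian group $\Gamma$ of order $N$, a $\Gamma$-distance magic labeling of $X$ is a bijection $f\colon V(X)\to\Gamma$ such that there is an element $\mu\in\Gamma$ (the magic constant) with $w(x)=\sum_{y\in N_X(x)} f(y)=\mu$ for every $x\in V(X)$, where $N_X(x)$ is the set of vertices adjacent to $x$. A graph $X$ is group distance magic if it has a $\Gamma$-distance magic labeling for every Abelian group $\Gamma$ of order $|V(X)|$. *)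

(* Defs.v *)
From mathcomp Require Import all_boot all_order all_algebra.

Set Implicit Arguments.
Unset Strict Implicit.
Unset Printing Implicit Defensive.

Import GRing.Theory.

Record sgraph := SGraph {
  vertex :> finType;
  adj : rel vertex;
  adj_sym : symmetric adj;
  adj_irr : irreflexive adj }.

Definition neighborhood (X : sgraph) (x : X) : {set X} := [set y | adj x y].

Definition degree (X : sgraph) (x : X) : nat := #|neighborhood x|.

Section Cycle.
Variables (m : nat) (m_gt2 : 2 < m).

Definition cycle_adj : rel 'I_m := [rel i j | (ordS i == j) || (ordS j == i)].

Lemma cycle_adj_sym : symmetric cycle_adj.
Proof. by move=> i j; apply: orbC. Qed.

Lemma cycle_adj_irr : irreflexive cycle_adj.
Proof.
move=> i; rewrite /cycle_adj /= orbb -val_eqE /=; apply/negbTE/eqP.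
have := ltn_ord i; rewrite leq_eqVlt => /orP[/eqP def_m|lt_im].
  have mm: i.+1 %% m = 0 by rewrite def_m modnn.
  by rewrite mm => i0; move: m_gt2; rewrite -def_m -i0.
by rewrite modn_small // => /eqP; rewrite eqn_leq ltnn.
Qed.

Definition cycle_graph : sgraph := SGraph cycle_adj_sym cycle_adj_irr.
End Cycle.

Definition C4 : sgraph := @cycle_graph 4 isT.

Section DirectProduct.
Variables G H : sgraph.

Definition dprod_adj : rel (G * H)%type :=
  [rel x y | adj x.1 y.1 && adj x.2 y.2].

Lemma dprod_adj_sym : symmetric dprod_adj.
Proof. by move=> x y; congr andb; apply: adj_sym. Qed.

Lemma dprod_adj_irr : irreflexive dprod_adj.
Proof. by move=> x; rewrite /dprod_adj /= adj_irr. Qed.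

Definition direct_product : sgraph := SGraph dprod_adj_sym dprod_adj_irr.
End DirectProduct.

Definition weight (X : sgraph) (Gamma : finZmodType) (f : X -> Gamma) (x : X) :
    Gamma :=
  (\sum_(y in neighborhood x) f y)%R.

Definition distance_magic_labeling (X : sgraph) (Gamma : finZmodType)
    (f : X -> Gamma) : Prop :=
  bijective f /\ exists mu : Gamma, forall x : X, weight f x = mu.

Definition group_distance_magic (X : sgraph) : Prop :=
  forall Gamma : finZmodType, #|Gamma| = #|X| ->
  exists f : X -> Gamma, distance_magic_labeling f.

(* Main.v *)
Require Import Defs.
From mathcomp Require Import all_boot all_order all_algebra.
From mathcomp Require Import fingroup cyclic pgroup.

(** The neighbours of [(g, i)] in [G x C4] are the pairs [(g', i - 1)] and
    [(g', i + 1)] with [g'] adjacent to [g], and [i - 1], [i + 1] are antipodal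
    on the 4-cycle.  So if the labels of [(g', j)] and [(g', j + 2)] always add
    up to the same element [s], then [(g, i)] has weight [deg g * s].

    Such a labeling exists exactly when Gamma splits into pairs
    [{x, s - x}], that is when the involution [x |-> s - x] has no fixed point,
    that is when [s] is not a double ([exists_antipodal_labeling]).  The weight
    is then constant as soon as [2 ^ (p + 2)] kills [s], since the degrees agree
    modulo [2 ^ (p + 2)].

    Both demands on [s] can be met ([exists_nondouble_torsion]).  As Gamma has
    even order, it has an element of order 2, so doubling is not injective and
    hence, by finiteness, not surjective: some [t] is not a double.  Then
    [s = (2k + 1) t] differs from [t] by a double, so it is not a double either,
    while [2 ^ (p + 2) s = |Gamma| t = 0]. *)

Set Implicit Arguments.
Unset Strict Implicit.
Unset Printing Implicit Defensive.

Import GRing.Theory.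
Local Open Scope ring_scope.

(** By Cauchy's theorem doubling has a nontrivial kernel, and on a finite set a
    map that is not injective cannot be surjective. *)
Lemma exists_nondouble (Gamma : finZmodType) :
  (2 %| #|Gamma|)%N -> exists t : Gamma, forall x, x *+ 2 != t.
Proof.
rewrite -cardsT => even_Gamma.
have [z _ ord_z] := Cauchy (G := [set: Gamma]%G) (isT : prime 2) even_Gamma.
have z_neq0 : z != 0.
  by apply: contra_eq_neq ord_z => ->; rewrite -FinRing.zmod1gE order1.
have z2 : z *+ 2 = 0.
  by rewrite -FinRing.zmodXgE -ord_z expg_order FinRing.zmod1gE.
suff /existsP[t /forallP t_nondouble] :
  [exists t : Gamma, [forall x, x *+ 2 != t]] by exists t.
move: z_neq0; apply: contraNT; rewrite negb_exists => /forallP surj_double.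
pose double (x : Gamma) := x *+ 2.
have card_double : (#|Gamma| <= #|codom double|)%N.
  apply/subset_leq_card/subsetP => t _.
  have := surj_double t; rewrite negb_forall => /existsP[x /negPn/eqP <-].
  exact: codom_f.
have /injectiveP inj_double : injectiveb double.
  have /image_injP inj : #|image double Gamma| == #|Gamma|.
    by rewrite eqn_leq leq_image_card.
  by apply/injectiveP => x y; apply: inj.
by apply/eqP/inj_double; rewrite /double z2 mul0rn.
Qed.

Lemma exists_nondouble_torsion (Gamma : finZmodType) (m k : nat) :
    #|Gamma| = (2 ^ m.+1 * (2 * k + 1))%N ->
  exists2 s : Gamma, s *+ 2 ^ m.+1 = 0 & forall x, x *+ 2 != s.
Proof.
move=> card_Gamma.
have [|t t_nondouble] := @exists_nondouble Gamma.
  by rewrite card_Gamma expnS -mulnA dvdn_mulr.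
exists (t *+ (2 * k + 1)) => [|x].
  rewrite -mulrnA mulnC -card_Gamma -cardsT -FinRing.zmodXgE.
  by apply/expg_cardG; rewrite inE.
apply: contra_neq (t_nondouble (x - t *+ k)) => double_x.
by rewrite mulrnBl double_x -mulrnA mulnC mulrnDr addrC addKr.
Qed.

(** From each two-element orbit of the involution, keep the element that comes
    first in the enumeration of [T]. *)
Lemma involution_transversal (T : finType) (sigma : T -> T) :
    involutive sigma -> (forall x, sigma x != x) ->
  exists A : {set T}, forall x, (sigma x \in A) = (x \notin A).
Proof.
move=> sigmaK sigma_free.
exists [set x | enum_rank x < enum_rank (sigma x)]%N => x.
rewrite !inE sigmaK -leqNgt [RHS]leq_eqVlt.
case: eqP => // /val_inj/enum_rank_inj fix_x.
by have := sigma_free x; rewrite fix_x eqxx.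
Qed.

Lemma card_involution_transversal (T : finType) (sigma : T -> T) (A : {set T}) :
    involutive sigma -> (forall x, (sigma x \in A) = (x \notin A)) ->
  #|T| = (#|A| * 2)%N.
Proof.
move=> sigmaK A_transv.
have cAE : ~: A = sigma @: A.
  apply/setP => x; rewrite inE -A_transv.
  by rewrite -{2}[x]sigmaK mem_imset //; apply: inv_inj.
by rewrite -(cardsC A) cAE card_imset ?addnn ?muln2 //; apply: inv_inj.
Qed.

Definition antipodal_sums (V : finType) (Gamma : zmodType) (s : Gamma)
    (f : V * 'I_4 -> Gamma) :=
  forall v (i j : 'I_4), i.+2 = j -> f (v, i) + f (v, j) = s.

(** A transversal of the pairs [{x, s - x}] has [2 |V|] elements, which label
    the positions 0 and 1 of the cycle; their partners label 2 and 3. *)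
Lemma exists_antipodal_labeling (V : finType) (Gamma : finZmodType)
    (s : Gamma) :
    #|Gamma| = (#|V| * 4)%N -> (forall x, x *+ 2 != s) ->
  exists2 f : V * 'I_4 -> Gamma, bijective f & antipodal_sums s f.
Proof.
move=> card_Gamma s_nondouble.
pose sigma x := s - x.
have sigmaK : involutive sigma by move=> x; rewrite /sigma subKr.
have sigma_free x : sigma x != x.
  by apply: contra_neq (s_nondouble x) => fix_x; rewrite mulr2n -{1}fix_x subrK.
have [A A_transv] := involution_transversal sigmaK sigma_free.
have card_A : #|{: V * bool}| = #|A|.
  apply/eqP; rewrite -(eqn_pmul2r (isT : 0 < 2)%N).
  rewrite -(card_involution_transversal sigmaK A_transv) card_Gamma.
  by rewrite card_prod card_bool -mulnA.
pose h (u : V * bool) := enum_val (cast_ord card_A (enum_rank u)).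
have h_in u : h u \in A by apply: enum_valP.
have h_inj : injective h.
  by move=> u v /enum_val_inj/cast_ord_inj/enum_rank_inj.
pose f (u : V * 'I_4) :=
  let x := h (u.1, odd u.2) in if (u.2 < 2)%N then x else sigma x.
have f_in u : (f u \in A) = (u.2 < 2)%N.
  by rewrite /f; case: ifP; rewrite ?A_transv h_in.
have f_inj : injective f.
  move=> [v i] [w j] eq_f.
  have eq_half : (i < 2)%N = (j < 2)%N by rewrite -(f_in (v, i)) eq_f f_in.
  have {eq_f} [-> eq_odd] : (v, odd i) = (w, odd j).
    apply: h_inj; move: eq_f; rewrite /f /= eq_half.
    by case: ifP => // _ /(inv_inj sigmaK).
  (* Parity and half together determine a position on the 4-cycle. *)
  congr (_, _); apply: val_inj.
  by case: i j eq_half eq_odd => [[|[|[|[|i]]]] ?] [[|[|[|[|j]]]] ?].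
exists f.
  by apply: inj_card_bij => //; rewrite card_prod card_ord card_Gamma.
move=> v i j def_j; have := ltn_ord j.
rewrite /f /= -def_j /= negbK !ltnS => lt_i2.
by rewrite lt_i2 addrC subrK.
Qed.

(** Both neighbours of [i] in the 4-cycle have the other parity, so they are
    antipodal. *)
Lemma antipodal_weight (G : sgraph) (Gamma : finZmodType) (s : Gamma)
    (f : direct_product G C4 -> Gamma) (x : direct_product G C4) :
  antipodal_sums s f -> weight f x = s *+ degree x.1.
Proof.
case: x => g i f_sums; rewrite /weight /degree /=.
rewrite -sumr_const.
transitivity (\sum_(g' in neighborhood g) \sum_(j | adj (s := C4) i j) f (g', j)).
  rewrite pair_big_dep; apply: eq_big => [[g' j]|[g' j]] //.
  by rewrite !inE.
apply: eq_bigr => g' _; rewrite big_mkcond /= !big_ord_recl big_ord0 /=.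
case: i => [[|[|[|[|i]]]] lt_i4] //=; rewrite ?add0r ?addr0; exact: f_sums.
Qed.

Lemma mulrz_eq_mod (V : zmodType) (s : V) (d a b : int) :
  s *~ d = 0 -> (a = b %[mod d])%Z -> s *~ a = s *~ b.
Proof.
move=> sd0 /eqP; rewrite eqz_mod_dvd => /dvdzP[q def_ab].
by apply/eqP; rewrite -subr_eq0 -mulrzBr def_ab mulrC mulrzA sd0 mul0rz.
Qed.

Local Close Scope ring_scope.

Theorem theorem2p3 (G : sgraph) (n p k : nat) (c : int)
    (order_G : #|G| = n)
    (n_fact : n = 2 ^ p * (2 * k + 1))
    (deg_G : forall v : G,
       ((degree v)%:Z = c %[mod (2 ^ (p + 2))%N%:Z])%Z) :
  group_distance_magic (direct_product G C4).
Proof.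
move=> Gamma; rewrite card_prod card_ord => card_Gamma.
have card_Gamma_fact : #|Gamma| = 2 ^ p.+2 * (2 * k + 1).
  by rewrite card_Gamma order_G n_fact mulnAC -[4]/(2 ^ 2) -expnD addn2.
have [s s_torsion s_nondouble] := exists_nondouble_torsion card_Gamma_fact.
have [f f_bij f_sums] := exists_antipodal_labeling card_Gamma s_nondouble.
exists f; split=> //; exists (s *~ c)%R => x.
rewrite (antipodal_weight x f_sums) pmulrn.
by apply: mulrz_eq_mod (deg_G x.1); rewrite addn2 -pmulrn.
Qed.
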